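(* Let $N\ge1$ and let $A\in\mathbb{R}^{N\times N}$ be symmetric with eigenvalues $d_1,\dots,d_N>0$. Let $\kappa,\nu,T>0$ and $\Gamma\in(0,T)$. For $\gamma>0$ let $\rho_{\mathrm{S1}}^{\mathrm{AS1}}(d_i)$ be the contraction factor for the eigenvalue $d_i$ of the alternating Schwarz algorithm (S1-AS1) with parameter $\alpha=0$, and let $\rho_{\mathrm{S2}}^{\mathrm{AS1}}(d_i)$ be the contraction factor for $d_i$ of the alternating Schwarz algorithm (S2-AS1) (both algorithms and their contraction factors are defined in the context). Then the convergence behavior of the two algorithms becomes the same as $\gamma\to\infty$, that is, for every $i=1,\dots,N$, $$\lim_{\gamma\to\infty}\rho_{\mathrm{S1}}^{\mathrm{AS1}}(d_i)\Big|_{\alpha=0}=\rho_{\mathrm{S2}}^{\mathrm{AS1}}(d_i).$$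
   Context: The matrix $A$ is a spatial discretization of $-\Delta$ with homogeneous Dirichlet conditions (e.g. centered finite differences). Problem (P1) is to minimize $\frac{\alpha}{2}\|y-\hat y\|_{L^2(Q)}^2+\frac{\gamma}{2}\|y(T,\cdot)-\hat y(T,\cdot)\|_{L^2(\Omega)}^2+\frac{\nu}{2}\|u\|_{L^2(Q)}^2$ subject to the heat equation $\partial_t y-\kappa\Delta y=u$ with $y=0$ on the lateral boundary and $y(0)=y_0$. Problem (P2) is to minimize $\frac{\nu}{2}\|u\|_{L^2(Q)}^2$ subject to the same heat equation and $y(T)=0$. Their semi-discrete optimality systems, for $\mathbb{R}^N$-valued $y,\lambda$ on $[0,T]$, are: (S1): $\dot y+\kappa Ay=\nu^{-1}\lambda$, $\dot\lambda-\kappa A\lambda=\alpha(y-\hat y)$, $y(0)=y_0$, $\lambda(T)=-\gamma(y(T)-\hat y(T))$; (S2): $\dot y+\kappa Ay=\nu^{-1}\lambda$, $\dot\lambda-\kappa A\lambda=0$, $y(0)=y_0$, $y(T)=0$. Alternating Schwarz algorithms of type AS1. The time interval is split at $\Gamma$ into $(0,\Gamma)$ (index 1) and $(\Gamma,T)$ (index 2). Starting from an initial guess $\lambda_2^0(\Gamma)\in\mathbb{R}^N$, for $\ell=1,2,\dots$ one solves first on $(0,\Gamma)$ for $(y_1^\ell,\lambda_1^\ell)$ and then on $(\Gamma,T)$ for $(y_2^\ell,\lambda_2^\ell)$. (S1-AS1): the differential equations of (S1) on each subinterval, with $y_1^\ell(0)=y_0$, $\lambda_1^\ell(\Gamma)=\lambda_2^{\ell-1}(\Gamma)$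 on the first, and $y_2^\ell(\Gamma)=y_1^\ell(\Gamma)$, $\lambda_2^\ell(T)+\gamma y_2^\ell(T)=\gamma\hat y(T)$ on the second. (S2-AS1): the differential equations of (S2) on each subinterval, with $y_1^\ell(0)=y_0$, $\lambda_1^\ell(\Gamma)=\lambda_2^{\ell-1}(\Gamma)$ on the first, and $y_2^\ell(\Gamma)=y_1^\ell(\Gamma)$, $y_2^\ell(T)=0$ on the second. Contraction factor. The errors (iterate minus exact solution of the corresponding system) satisfy the same iteration with homogeneous data $y_0=0$, $\hat y=0$. Diagonalizing $A$ orthogonally decouples the error iteration into $N$ independent scalar iterations, one for each $d_i$ (replace $A$ by $d_i$). In the $i$-th one, the second-subinterval error components satisfy $y_{2,i}^{\ell}=\rho(d_i)\,y_{2,i}^{\ell-1}$ for $\ell\ge2$ (equivalently $\lambda_{2,i}^{\ell}(\Gamma)=\rho(d_i)\,\lambda_{2,i}^{\ell-1}(\Gamma)$ for $\ell\ge1$, for iterates in the range of the iteration), with a number $\rho(d_i)$ independent of $\ell$ and of the initial guess. This number is the contraction factor of the algorithm for $d_i$; the size $|\rho(d_i)|$ measures the contraction of the $i$-th mode. *)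

(* Defs.v *)
From HB Require Import structures.
From mathcomp Require Import all_boot all_order all_algebra.
From mathcomp Require Import all_classical all_reals all_analysis.
Set Implicit Arguments.
Unset Strict Implicit.
Unset Printing Implicit Defensive.
Import Order.TTheory GRing.Theory Num.Theory.
Import numFieldNormedType.Exports.
Local Open Scope ring_scope.
Local Open Scope classical_set_scope.

(* Classical solutions on [a, b]: continuous up to the endpoints, with the
   equations y' + kappa A y = nu^-1 l and l' - kappa A l = f holding in the
   open interval. *)
Definition state_adjoint_ode (R : realType) (N : nat) (A : 'M[R]_N)
    (kappa nu : R) (f : R -> 'cV[R]_N) (a b : R) (y l : R -> 'cV[R]_N) : Prop :=
  [/\ {within `[a, b], continuous y},
      {within `[a, b], continuous l} &
      forall t : R, a < t < b ->
        [/\ derivable y t 1,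
            derivable l t 1,
            derive1 y t + kappa *: (A *m y t) = nu^-1 *: l t &
            derive1 l t - kappa *: (A *m l t) = f t]].

Definition S1_ode (R : realType) (N : nat) (A : 'M[R]_N) (kappa nu alpha : R)
    (yhat : R -> 'cV[R]_N) (a b : R) (y l : R -> 'cV[R]_N) : Prop :=
  state_adjoint_ode A kappa nu (fun t => alpha *: (y t - yhat t)) a b y l.

Definition S2_ode (R : realType) (N : nat) (A : 'M[R]_N) (kappa nu : R)
    (a b : R) (y l : R -> 'cV[R]_N) : Prop :=
  state_adjoint_ode A kappa nu (fun=> 0) a b y l.

(* Optimality system with tracking (weight alpha) and terminal cost
   (weight gamma). *)
Definition S1_solution (R : realType) (N : nat) (A : 'M[R]_N)
    (kappa nu alpha gamma T : R) (y0 : 'cV[R]_N) (yhat : R -> 'cV[R]_N)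
    (y l : R -> 'cV[R]_N) : Prop :=
  [/\ S1_ode A kappa nu alpha yhat 0 T y l,
      y 0 = y0 &
      l T = - (gamma *: (y T - yhat T))].

(* Optimality system of the exact null-control problem. *)
Definition S2_solution (R : realType) (N : nat) (A : 'M[R]_N)
    (kappa nu T : R) (y0 : 'cV[R]_N) (y l : R -> 'cV[R]_N) : Prop :=
  [/\ S2_ode A kappa nu 0 T y l, y 0 = y0 & y T = 0].

(* Step k.+1 solves first on [0, Gamma], then on [Gamma, T].  The only
   constrained datum at index 0 is l2 0 Gamma, the arbitrary initial guess;
   the rest of y1 0, l1 0, y2 0, l2 0 is never used. *)
Definition S1_AS1_iterates (R : realType) (N : nat) (A : 'M[R]_N)
    (kappa nu alpha gamma T Gamma : R) (y0 : 'cV[R]_N) (yhat : R -> 'cV[R]_N)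
    (y1 l1 y2 l2 : nat -> R -> 'cV[R]_N) : Prop :=
  forall k : nat,
    [/\ S1_ode A kappa nu alpha yhat 0 Gamma (y1 k.+1) (l1 k.+1),
        y1 k.+1 0 = y0 &
        l1 k.+1 Gamma = l2 k Gamma] /\
    [/\ S1_ode A kappa nu alpha yhat Gamma T (y2 k.+1) (l2 k.+1),
        y2 k.+1 Gamma = y1 k.+1 Gamma &
        l2 k.+1 T + gamma *: y2 k.+1 T = gamma *: yhat T].

Definition S2_AS1_iterates (R : realType) (N : nat) (A : 'M[R]_N)
    (kappa nu T Gamma : R) (y0 : 'cV[R]_N)
    (y1 l1 y2 l2 : nat -> R -> 'cV[R]_N) : Prop :=
  forall k : nat,
    [/\ S2_ode A kappa nu 0 Gamma (y1 k.+1) (l1 k.+1),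
        y1 k.+1 0 = y0 &
        l1 k.+1 Gamma = l2 k Gamma] /\
    [/\ S2_ode A kappa nu Gamma T (y2 k.+1) (l2 k.+1),
        y2 k.+1 Gamma = y1 k.+1 Gamma &
        y2 k.+1 T = 0].

(* d lists all eigenvalues of A, with algebraic multiplicity. *)
Definition eigenvalue_list (R : realType) (N : nat) (A : 'M[R]_N)
    (d : 'I_N -> R) : Prop :=
  char_poly A = \prod_(j < N) ('X - (d j)%:P).

(* Column j of P is an eigenvector for d j. *)
Definition orthogonal_diagonalization (R : realType) (N : nat)
    (A P : 'M[R]_N) (d : 'I_N -> R) : Prop :=
  P^T *m P = 1%:M /\ P^T *m A *m P = diag_mx (\row_j d j).

(* In the coordinates P^T, component i of the error y2 k - y on [Gamma, T] is
   multiplied by rho at every step from k >= 1 to k + 1. *)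
Definition mode_contracts (R : realType) (N : nat) (P : 'M[R]_N) (i : 'I_N)
    (Gamma T : R) (y : R -> 'cV[R]_N) (y2 : nat -> R -> 'cV[R]_N) (rho : R)
    : Prop :=
  forall (k : nat) (t : R), (1 <= k)%N -> Gamma <= t <= T ->
    (P^T *m (y2 k.+1 t - y t)) i 0 = rho * (P^T *m (y2 k t - y t)) i 0.

(* One number must serve every step, initial guess, set of data and choice of
   orthonormal eigenbasis. *)
Definition S1_AS1_contraction_factor (R : realType) (N : nat) (A : 'M[R]_N)
    (d : 'I_N -> R) (kappa nu alpha gamma T Gamma : R) (i : 'I_N) (rho : R)
    : Prop :=
  forall (P : 'M[R]_N) (y0 : 'cV[R]_N) (yhat : R -> 'cV[R]_N)
         (y l : R -> 'cV[R]_N) (y1 l1 y2 l2 : nat -> R -> 'cV[R]_N),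
    orthogonal_diagonalization A P d ->
    S1_solution A kappa nu alpha gamma T y0 yhat y l ->
    S1_AS1_iterates A kappa nu alpha gamma T Gamma y0 yhat y1 l1 y2 l2 ->
    mode_contracts P i Gamma T y y2 rho.

Definition S2_AS1_contraction_factor (R : realType) (N : nat) (A : 'M[R]_N)
    (d : 'I_N -> R) (kappa nu T Gamma : R) (i : 'I_N) (rho : R) : Prop :=
  forall (P : 'M[R]_N) (y0 : 'cV[R]_N)
         (y l : R -> 'cV[R]_N) (y1 l1 y2 l2 : nat -> R -> 'cV[R]_N),
    orthogonal_diagonalization A P d ->
    S2_solution A kappa nu T y0 y l ->
    S2_AS1_iterates A kappa nu T Gamma y0 y1 l1 y2 l2 ->
    mode_contracts P i Gamma T y y2 rho.

(* Main.v *)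
(* Projecting the error equations on an eigenvector of A gives the scalar system
   z' + c z = n m, m' = c m with c = kappa d_i and n = 1/nu, whose solutions are
   explicit.  On (0, Gamma) this yields z(Gamma) = state_gain * m(Gamma).  For
   alpha = 0 the S1 terminal condition reads p m(T) + z(T) = 0 with p = 1/gamma,
   and the S2 one is the case p = 0; either yields
   m(Gamma) = adjoint_gain(p) * z(Gamma) on (Gamma, T).  So the contraction factor
   is state_gain * adjoint_gain(p), continuous at p = 0.  It is unique because the
   iteration can be started along an actual eigenvector of A. *)

Require Import Defs.
From HB Require Import structures.
From mathcomp Require Import all_boot all_order all_algebra.
From mathcomp Require Import all_classical all_reals all_analysis.
From mathcomp Require Import ring lra.
Set Implicit Arguments.
Unset Strict Implicit.
Unset Printing Implicit Defensive.
Import Order.TTheory GRing.Theory Num.Theory.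
Import numFieldNormedType.Exports.
Local Open Scope ring_scope.
Local Open Scope classical_set_scope.

(** * Orthogonal diagonalization of symmetric real matrices with a prescribed eigenvalue list *)

Lemma trmx_mul_self (R : realFieldType) n (w : 'cV[R]_n) :
  w^T *m w = (\sum_j w j 0 ^+ 2)%:M.
Proof.
apply/matrixP => i j; rewrite !ord1 !mxE eqxx mulr1n.
by apply: eq_bigr => k _; rewrite !mxE expr2.
Qed.

Lemma sum_sqr_gt0 (R : realFieldType) n (w : 'cV[R]_n) :
  w != 0 -> 0 < \sum_j w j 0 ^+ 2.
Proof.
move=> w0; rewrite lt_neqAle sumr_ge0 ?andbT; last by move=> *; rewrite sqr_ge0.
apply: contra w0 => /eqP/esym/eqP; rewrite psumr_eq0; last first.
  by move=> *; rewrite sqr_ge0.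
move/allP => h; apply/eqP/matrixP => i j; rewrite !ord1 mxE.
by have := h i (mem_index_enum _); rewrite sqrf_eq0 => /eqP.
Qed.

(** The reflection along [v - e] exchanges two vectors of equal norm. Being a symmetric involution
    it is orthogonal; it serves to carry the first basis vector to a unit eigenvector. *)
Lemma householder (R : realFieldType) n (e v : 'cV[R]_n) :
  e^T *m e = v^T *m v ->
  exists H : 'M[R]_n, [/\ H^T = H, H *m H = 1%:M & H *m e = v].
Proof.
move=> ev; have [<-|ve] := eqVneq v e.
  by exists 1%:M; rewrite trmx1 !mul1mx.
pose w := v - e; pose q := \sum_j w j 0 ^+ 2.
have w0 : w != 0 by rewrite subr_eq0.
have q0 : q != 0 by rewrite gt_eqF // sum_sqr_gt0.
have qE : w^T *m w = q%:M := trmx_mul_self w.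
exists (1%:M - (2 / q) *: (w *m w^T)).
(* Equal norms give [w^T w = -2 w^T e]. Reflecting [e] therefore adds exactly [w], which gives
   [v]. *)
have we : w^T *m e = (- q / 2)%:M.
  have ves : v^T *m e = e^T *m v.
    apply: trmx_inj; rewrite trmx_mul trmxK.
    by apply/matrixP => i j; rewrite !ord1 !mxE; apply: eq_bigr => k _; rewrite !mxE mulrC.
  move: qE; rewrite /w mulmxBr [_^T]linearB /=.
  rewrite !mulmxBl ves -ev.
  move/matrixP/(_ 0 0); rewrite !mxE eqxx !mulr1n => h.
  apply/matrixP => i j; rewrite !ord1 !mxE eqxx mulr1n -h; lra.
split.
- by rewrite linearB linearZ /= trmx1 trmx_mul trmxK.
- set W := w *m w^T; have WW : W *m W = q *: W.
    by rewrite mulmxA -(mulmxA w) qE mul_mx_scalar -scalemxAl.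
  rewrite mulmxBl mul1mx mulmxBr mulmx1 -scalemxAl -scalemxAr WW !scalerA.
  rewrite (_ : 2 / q * (2 / q) * q = 2 / q + 2 / q); last by field.
  by rewrite scalerDl opprB addrK subrK.
- rewrite mulmxBl mul1mx -scalemxAl -mulmxA we mul_mx_scalar scalerA.
  rewrite (_ : 2 / q * _ = -1); last by field.
  by rewrite scaleN1r opprK addrC subrK.
Qed.

(** A root of the characteristic polynomial gives a row eigenvector; symmetry of [A] lets it be
    transposed into a column one, which is then normalized. *)
Lemma unit_eigenvector (R : rcfType) n (A : 'M[R]_n) (a : R) :
  A^T = A -> root (char_poly A) a ->
  exists v : 'cV[R]_n, v^T *m v = 1%:M /\ A *m v = a *: v.
Proof.
move=> AT; rewrite -eigenvalue_root_char => /eigenvalueP[u uA u0].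
have Au : A *m u^T = a *: u^T by rewrite -{1}AT -trmx_mul uA linearZ.
pose q := \sum_j u^T j 0 ^+ 2.
have q0 : 0 < q by rewrite sum_sqr_gt0 // trmx_eq0.
exists ((Num.sqrt q)^-1 *: u^T); split; last first.
  by rewrite -scalemxAr Au scalerA mulrC -scalerA.
rewrite [_^T]linearZ /= -scalemxAl -scalemxAr scalerA -invfM -expr2.
by rewrite sqr_sqrtr ?ltW // trmx_mul_self scale_scalar_mx mulVf ?gt_eqF.
Qed.

Lemma char_poly_conj (R : fieldType) n (H K A : 'M[R]_n) :
  H *m K = 1%:M -> K *m H = 1%:M -> char_poly (K *m A *m H) = char_poly A.
Proof.
move=> HK KH; rewrite /char_poly.
have -> : char_poly_mx (K *m A *m H) =
    map_mx polyC K *m char_poly_mx A *m map_mx polyC H.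
  rewrite /char_poly_mx mulmxBr mulmxBl !map_mxM /=; congr (_ - _).
  by rewrite mul_mx_scalar -scalemxAl -map_mxM KH map_mx1 scalemx1.
by rewrite !det_mulmx mulrAC -det_mulmx -map_mxM KH map_mx1 det1 mul1r.
Qed.

(** Spectral theorem by deflation: a Householder conjugation makes the first basis vector an
    eigenvector for [d ord0], and induction treats the remaining block. The order of the eigenvalues
    is the one fixed by [d]. *)
Lemma exists_orthogonal_diagonalization (R : realType) n (A : 'M[R]_n)
    (d : 'I_n -> R) :
  A^T = A -> eigenvalue_list A d ->
  exists P : 'M[R]_n, orthogonal_diagonalization A P d.
Proof.
elim: n A d => [|n IH] A d AT Ad.
  by exists 1%:M; split; apply/matrixP => -[].
have [|v [vv Av]] := @unit_eigenvector R _ A (d ord0) AT.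
  by rewrite Ad big_ord_recl rootM root_XsubC eqxx.
pose e : 'cV[R]_(1 + n) := delta_mx 0 0.
have [|H [HT HH He]] := @householder _ _ e v.
  rewrite vv trmx_delta mul_delta_mx; apply/matrixP => i j.
  by rewrite !ord1 !mxE.
pose B : 'M[R]_(1 + n) := H *m A *m H.
have BT : B^T = B by rewrite /B !trmx_mul HT AT mulmxA.
have Be : B *m e = d ord0 *: e.
  by rewrite /B -!mulmxA He Av -scalemxAr -He mulmxA HH mul1mx.
have cB : char_poly B = char_poly A by exact: char_poly_conj.
have BD : H *m A *m H = B by [].
clearbody B.
have B0 i : B i 0 = d ord0 *+ (i == 0).
  have := congr1 (fun M : 'cV_(1 + n) => M i 0) Be.
  by rewrite -colE !mxE eqxx andbT mulr_natr.
(* The first column is [d ord0] times the first basis vector; symmetry clears the first row as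
   well. *)
have BE : B = block_mx (d ord0)%:M 0 0 (drsubmx B).
  rewrite -[LHS]submxK; congr block_mx; apply/matrixP => i j.
  - by rewrite !ord1 !mxE lshift0 B0 !eqxx mulr1n.
  - rewrite !ord1 !mxE lshift0 -[LHS](mxE trmx_key (fun i j => B j i)) -/(B^T) BT B0.
    by [].
  - by rewrite !ord1 !mxE lshift0 B0.
have DT : (drsubmx B)^T = drsubmx B by rewrite trmx_drsub BT.
(* Conjugation preserves the characteristic polynomial, so cancelling the factor ['X - d ord0]
   leaves the eigenvalue list of the lower block. *)
have [|Q [QQ QD]] := IH (drsubmx B) (fun j => d (lift ord0 j)) DT.
  move: cB; rewrite BE /char_poly char_block_diag_mx det_ublock -/(char_poly _) Ad big_ord_recl.
  rewrite -/(char_poly _) {1}/char_poly det_mx11 !mxE eqxx !mulr1n.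
  by rewrite block_mxKdr => /(mulfI (negbT (polyXsubC_eq0 _))).
pose S : 'M[R]_(1 + n) := block_mx 1%:M 0 0 Q.
have ST : S^T = block_mx 1%:M 0 0 Q^T by rewrite tr_block_mx !trmx0 trmx1.
have SS : S^T *m S = 1%:M.
  rewrite ST mulmx_block !mulmx0 !mul0mx !addr0 !add0r mulmx1 QQ.
  by rewrite -scalar_mx_block.
have SBS : S^T *m B *m S = block_mx (d ord0)%:M 0 0 (diag_mx (\row_j d (lift ord0 j))).
  rewrite BE ST mulmx_block !(mulmx0, mul0mx, addr0, add0r, mul1mx).
  by rewrite mulmx_block !(mulmx0, mul0mx, addr0, add0r, mulmx1) QD.
exists (H *m S); split.
- by rewrite trmx_mul HT mulmxA -(mulmxA _ H H) HH mulmx1.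
- rewrite trmx_mul HT !mulmxA -(mulmxA _ H A) -(mulmxA _ (H *m A) H) BD SBS.
  apply/matrixP => i j.
  case: (@split_ordP 1 n i) => k ->; case: (@split_ordP 1 n j) => l ->.
  - by rewrite [LHS]block_mxEul !ord1 !mxE lshift0 !eqxx.
  - rewrite [LHS]block_mxEur !mxE; case: eqP => // /(congr1 val) /=.
    by rewrite ord1.
  - rewrite [LHS]block_mxEdl !mxE; case: eqP => // /(congr1 val) /=.
    by rewrite (ord1 l).
  - rewrite [LHS]block_mxEdr !mxE -[RHS]/(d (rshift 1 k) *+ _).
    by congr (d _ *+ nat_of_bool _); exact: val_inj.
Qed.

(** * The scalar system of one mode and its explicit solutions *)

(** Mean value theorem on [[a, t]]. Continuity up to the ends covers [t = b], where no derivative is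
    assumed. *)
Lemma derive0_constant (R : realType) (f : R -> R) (a b t : R) :
  {within `[a, b], continuous f} ->
  (forall s : R, a < s < b -> is_derive s 1 f 0) ->
  a <= t <= b -> f t = f a.
Proof.
move=> fc f0 /andP[le_at le_tb].
have [||s _] := @MVT_segment R f (fun=> 0) a t le_at.
- move=> s; rewrite in_itv /= => /andP[lt_as lt_st]; apply: f0.
  by rewrite lt_as (lt_le_trans lt_st le_tb).
- apply: continuous_subspaceW fc => s /=; rewrite !in_itv /= => /andP[-> lt_st].
  exact: le_trans le_tb.
- by rewrite mul0r => /eqP; rewrite subr_eq0 => /eqP.
Qed.

Lemma is_derive_expR_affine (R : realType) (c a t : R) :
  is_derive t 1 (fun s => expR (c * (s - a))) (c * expR (c * (t - a))).
Proof.
have h : is_derive t 1 (fun s : R => c * (s - a)) c.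
  have -> : (fun s : R => c * (s - a)) = c *: (id - cst a) by [].
  by apply: is_derive_eq; rewrite subr0 /GRing.scale /= mulr1.
by rewrite mulrC; apply: is_derive1_comp.
Qed.

Definition mode_ode (R : realType) (c n a b : R) (z lam : R -> R) : Prop :=
  [/\ {within `[a, b], continuous z},
      {within `[a, b], continuous lam} &
      forall t : R, a < t < b ->
        is_derive t 1 z (n * lam t - c * z t) /\
        is_derive t 1 lam (c * lam t)].

Lemma mode_odeB (R : realType) (c n a b : R) (z1 lam1 z2 lam2 : R -> R) :
  mode_ode c n a b z1 lam1 -> mode_ode c n a b z2 lam2 ->
  mode_ode c n a b (z1 - z2) (lam1 - lam2).
Proof.
move=> [z1c l1c h1] [z2c l2c h2]; split; try exact: within_continuousB.
move=> t abt; have [dz1 dl1] := h1 t abt; have [dz2 dl2] := h2 t abt.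
by split; apply: is_derive_eq; rewrite /= !fctE; ring.
Qed.

Lemma mode_ode_subitv (R : realType) (c n a b a' b' : R) (z lam : R -> R) :
  a <= a' -> b' <= b -> mode_ode c n a b z lam -> mode_ode c n a' b' z lam.
Proof.
move=> aa bb [zc lc h]; have sub : `[a', b'] `<=` `[a, b].
  by move=> s /=; rewrite !in_itv /= => /andP[/(le_trans aa)-> /le_trans->].
split; try by [exact: continuous_subspaceW zc|exact: continuous_subspaceW lc].
by move=> t /andP[at' tb']; apply: h; rewrite (le_lt_trans aa) ?(lt_le_trans tb').
Qed.

(* [sinhc c x] is the response at time x of z' + c z = e^(c s), z(0) = 0. *)
Definition sinhc (R : realType) (c x : R) : R :=
  (expR (c * x) - expR (- (c * x))) / (2 * c).

Lemma sinhc0 (R : realType) (c : R) : sinhc c 0 = 0.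
Proof. by rewrite /sinhc mulr0 oppr0 subrr mul0r. Qed.

Lemma sinhc_gt0 (R : realType) (c x : R) : 0 < c -> 0 < x -> 0 < sinhc c x.
Proof.
move=> c0 x0; rewrite divr_gt0 ?mulr_gt0 // subr_gt0 ltr_expR.
by rewrite gt0_cp ?mulr_gt0.
Qed.

Lemma is_derive_sinhc_affine (R : realType) (c a t : R) : c != 0 ->
  is_derive t 1 (fun s => sinhc c (s - a))
    (expR (c * (t - a)) - c * sinhc c (t - a)).
Proof.
move=> c0.
have -> : (fun s => sinhc c (s - a)) =
    (2 * c)^-1 *: ((fun s => expR (c * (s - a))) - (fun s => expR (- c * (s - a)))).
  by apply/funext => s; rewrite /sinhc !fctE mulrC mulNr.
have dp := is_derive_expR_affine c a t.
have dm := is_derive_expR_affine (- c) a t.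
apply: is_derive_eq; rewrite /sinhc /GRing.scale /= !mulNr; field.
by rewrite c0.
Qed.

Definition free_adjoint (R : realType) (c a l0 t : R) : R :=
  l0 * expR (c * (t - a)).

(** Duhamel's formula: decay of the value [z0] at time [a], plus the response to the forcing
    [n * free_adjoint c a l0]. *)
Definition free_state (R : realType) (c n a z0 l0 t : R) : R :=
  z0 * expR (- (c * (t - a))) + n * l0 * sinhc c (t - a).

Lemma is_derive_free_adjoint (R : realType) (c a l0 t : R) :
  is_derive t 1 (free_adjoint c a l0) (c * free_adjoint c a l0 t).
Proof.
rewrite /free_adjoint.
have -> : (fun s => l0 * expR (c * (s - a))) = l0 *: (fun s => expR (c * (s - a))).
  by [].
have dp := is_derive_expR_affine c a t.
by apply: is_derive_eq; rewrite /GRing.scale /=; ring.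
Qed.

Lemma is_derive_free_state (R : realType) (c n a z0 l0 t : R) : c != 0 ->
  is_derive t 1 (free_state c n a z0 l0)
    (n * free_adjoint c a l0 t - c * free_state c n a z0 l0 t).
Proof.
move=> c0; rewrite /free_state /free_adjoint.
have -> : (fun s => z0 * expR (- (c * (s - a))) + n * l0 * sinhc c (s - a)) =
    z0 *: (fun s => expR (- c * (s - a))) + (n * l0) *: (fun s => sinhc c (s - a)).
  by apply/funext => s; rewrite !fctE mulNr.
have dm := is_derive_expR_affine (- c) a t.
have ds := is_derive_sinhc_affine a t c0.
by apply: is_derive_eq; rewrite /GRing.scale /= !mulNr; ring.
Qed.

(** Uniqueness by two conserved quantities, one for each eigenvalue [c] and [-c] of the triangular
    system; solving them for [lam t] and [z t] gives the formulas. *)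
Lemma mode_ode_solution (R : realType) (c n a b t : R) (z lam : R -> R) :
  c != 0 -> mode_ode c n a b z lam -> a <= t <= b ->
  lam t = free_adjoint c a (lam a) t /\ z t = free_state c n a (z a) (lam a) t.
Proof.
rewrite /free_adjoint /free_state => c0 [zc lc h] abt.
have Ec k : {within `[a, b], continuous (fun s => expR (k * (s - a)))}.
  apply: derivable_within_continuous => s _.
  by have := is_derive_expR_affine k a s; case.
have lamE : lam t * expR (- c * (t - a)) = lam a.
  pose f := lam * (fun s => expR (- c * (s - a))).
  have := @derive0_constant R f a b t _ _ abt.
  rewrite /f !fctE subrr mulr0 expR0 mulr1; apply.
    by move=> s; apply: cvgM; [exact: lc|exact: Ec].
  move=> s /h[_ dl]; have dm := is_derive_expR_affine (- c) a s.
  by apply: is_derive_eq; rewrite /GRing.scale /=; ring.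
(* The combination [w = z - n / (2 c) lam] absorbs the forcing: it satisfies [w' = - c w]. *)
have zE : (z t - n / (2 * c) * lam t) * expR (c * (t - a)) = z a - n / (2 * c) * lam a.
  pose f := (z - (n / (2 * c)) *: lam) * (fun s => expR (c * (s - a))).
  have := @derive0_constant R f a b t _ _ abt.
  rewrite /f !fctE subrr mulr0 expR0 mulr1; apply.
    move=> s; apply: cvgM; last exact: Ec.
    by apply: cvgB; [exact: zc|apply: cvgZr; exact: lc].
  move=> s /h[dz dl]; have dp := is_derive_expR_affine c a s.
  by apply: is_derive_eq; rewrite /GRing.scale /=; field.
have lamt : lam t = lam a * expR (c * (t - a)).
  by rewrite -lamE -mulrA -expRD mulNr addNr expR0 mulr1.
split=> //.
have : z t - n / (2 * c) * lam t =
    (z a - n / (2 * c) * lam a) * expR (- (c * (t - a))).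
  by rewrite -zE -[RHS]mulrA -expRD subrr expR0 mulr1.
rewrite lamt /sinhc => /eqP; rewrite subr_eq => /eqP ->.
by field.
Qed.

(** * Passage from the matrix system to its modes and back *)

Lemma is_derive_mulmx (R : realType) m n p (B : 'M[R]_(m, n))
    (y : R -> 'M[R]_(n, p)) (t : R) i j :
  derivable y t 1 ->
  is_derive t 1 (fun s => (B *m y s) i j) ((B *m derive1 y t) i j).
Proof.
move=> dy.
have -> : (fun s => (B *m y s) i j) = \sum_k (B i k *: (fun s => y s k j)).
  by apply/funext => s; rewrite mxE fct_sumE.
have dk k : is_derive t 1 (fun s => y s k j) (derive1 y t k j).
  rewrite derive1E derive_mx // mxE; apply/derivableP.
  by move/derivable_mxP : dy; apply.
by apply: is_derive_eq; rewrite mxE.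
Qed.

Lemma continuous_mulmx_coord (R : realType) m n p (B : 'M[R]_(m, n))
    (y : R -> 'M[R]_(n, p)) (D : set R) i j :
  {within D, continuous y} -> {within D, continuous (fun s => (B *m y s) i j)}.
Proof.
move=> yc.
have -> : (fun s => (B *m y s) i j) = \sum_k (B i k *: (fun s => y s k j)).
  by apply/funext => s; rewrite mxE fct_sumE.
elim/big_ind: _ => [|f g fc gc|k _ s].
- exact: cst_continuous.
- exact: within_continuousD.
- apply: cvgZr; have := cvg_comp (y : subspace D -> _) (fun M : (matrix R n p) => M k j) (yc s).
  by apply; exact: coord_continuous.
Qed.

Lemma is_derive_scalel (R : realType) (V : normedModType R) (z : R -> R) (v : V)
    (t dz : R) :
  is_derive t 1 z dz -> is_derive t 1 (fun s => z s *: v) (dz *: v).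
Proof.
move=> [/derivable1_diffP dz' <-].
have dzv : differentiable (fun s => z s *: v) t by exact: differentiableZl.
split; first exact/derivable1_diffP.
by rewrite deriveE // diffZl // -deriveE.
Qed.

Lemma tr_mul_diagonalized (R : realType) N (A P : 'M[R]_N) (d : 'I_N -> R) :
  orthogonal_diagonalization A P d ->
  P^T *m A = diag_mx (\row_j d j) *m P^T /\ A *m P = P *m diag_mx (\row_j d j).
Proof.
move=> [PP <-]; have PP' := mulmx1C PP.
by rewrite -!mulmxA PP' mulmx1 !mulmxA PP' mul1mx.
Qed.

Lemma mode_ode_coord (R : realType) N (A P : 'M[R]_N) (d : 'I_N -> R)
    (kappa nu a b : R) (y l : R -> 'cV[R]_N) i :
  orthogonal_diagonalization A P d -> S2_ode A kappa nu a b y l ->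
  mode_ode (kappa * d i) nu^-1 a b
    (fun t => (P^T *m y t) i 0) (fun t => (P^T *m l t) i 0).
Proof.
move=> /tr_mul_diagonalized[PA _] [yc lc h].
have PAE (w : 'cV[R]_N) : (P^T *m (A *m w)) i 0 = d i * (P^T *m w) i 0.
  by rewrite mulmxA PA -mulmxA mul_diag_mx mxE mxE.
have pZ k (w : 'cV[R]_N) : (P^T *m (k *: w)) i 0 = k * (P^T *m w) i 0.
  by rewrite -scalemxAr mxE.
have pB (u w : 'cV[R]_N) :
    (P^T *m (u - w)) i 0 = (P^T *m u) i 0 - (P^T *m w) i 0.
  by rewrite mulmxBr !mxE.
split; try exact: continuous_mulmx_coord.
move=> t /h[dy dl yE lE].
have {}yE : derive1 y t = nu^-1 *: l t - kappa *: (A *m y t) by rewrite -yE addrK.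
have {}lE : derive1 l t = kappa *: (A *m l t) by apply/eqP; rewrite -subr_eq0 lE.
have := @is_derive_mulmx R _ _ _ P^T y t i 0 dy.
have := @is_derive_mulmx R _ _ _ P^T l t i 0 dl.
by rewrite yE lE pB !pZ !PAE !mulrA.
Qed.

(** Converse of the projection onto modes: explicit scalar solutions along an eigenvector solve the
    full system. This supplies the concrete iterates behind uniqueness of the factor. *)
Lemma free_eigenmode_ode (R : realType) N (A : 'M[R]_N) (mu kappa nu a b t0 z0 l0 : R)
    (v : 'cV[R]_N) :
  kappa * mu != 0 -> A *m v = mu *: v ->
  S2_ode A kappa nu a b
    (fun t => free_state (kappa * mu) nu^-1 t0 z0 l0 t *: v)
    (fun t => free_adjoint (kappa * mu) t0 l0 t *: v).
Proof.
move=> c0 Av.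
have dz t := is_derive_scalel v (is_derive_free_state nu^-1 t0 z0 l0 t c0).
have dl t := is_derive_scalel v (is_derive_free_adjoint (kappa * mu) t0 l0 t).
split.
- by apply: derivable_within_continuous => t _; have [] := dz t.
- by apply: derivable_within_continuous => t _; have [] := dl t.
- move=> t _; have [dzt dztE] := dz t; have [dlt dltE] := dl t.
  split=> //.
  + rewrite derive1E dztE -scalemxAr Av !scalerA -scalerDl; congr (_ *: _); ring.
  + by rewrite derive1E dltE -scalemxAr Av !scalerA -scalerBl mulrAC subrr scale0r.
Qed.

(** * Gains of the two subintervals and contraction of a single mode *)

(* First subinterval: y1(Gamma) = state_gain * lambda1(Gamma) when y1(0) = 0. *)
Definition state_gain (R : realType) (c n Gamma : R) : R :=
  n * expR (- (c * Gamma)) * sinhc c Gamma.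

(* Second subinterval, of length D: lambda2(Gamma) = adjoint_gain * y2(Gamma)
   under the terminal condition p lambda2(T) + y2(T) = 0. *)
Definition adjoint_gain (R : realType) (c n D p : R) : R :=
  - expR (- (c * D)) / (p * expR (c * D) + n * sinhc c D).

Definition AS1_rho (R : realType) (c n T Gamma p : R) : R :=
  state_gain c n Gamma * adjoint_gain c n (T - Gamma) p.

Lemma adjoint_gain_den_gt0 (R : realType) (c n D p : R) :
  0 < c -> 0 < n -> 0 < D -> 0 <= p -> 0 < p * expR (c * D) + n * sinhc c D.
Proof.
move=> c0 n0 D0 p0; rewrite ltr_wpDl ?mulr_ge0 ?expR_ge0 //.
by rewrite mulr_gt0 ?sinhc_gt0.
Qed.

Lemma free_adjointa (R : realType) (c a l0 : R) : free_adjoint c a l0 a = l0.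
Proof. by rewrite /free_adjoint subrr mulr0 expR0 mulr1. Qed.

Lemma free_statea (R : realType) (c n a z0 l0 : R) : free_state c n a z0 l0 a = z0.
Proof. by rewrite /free_state subrr mulr0 oppr0 expR0 sinhc0 mulr1 mulr0 addr0. Qed.

Lemma free_stateZ (R : realType) (c n a k z0 l0 t : R) :
  free_state c n a (k * z0) (k * l0) t = k * free_state c n a z0 l0 t.
Proof. by rewrite /free_state; ring. Qed.

(** Explicit solutions start at time [0], while the iteration prescribes the adjoint at [Gamma]: the
    initial value [expR (- (c * Gamma)) * L] is the one that grows to [L] there. *)
Lemma free_state_left (R : realType) (c n Gamma L : R) :
  free_state c n 0 0 (expR (- (c * Gamma)) * L) Gamma = state_gain c n Gamma * L.
Proof. by rewrite /free_state /state_gain subr0; ring. Qed.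

Lemma free_adjoint_left (R : realType) (c Gamma L : R) :
  free_adjoint c 0 (expR (- (c * Gamma)) * L) Gamma = L.
Proof. by rewrite /free_adjoint subr0 mulrAC -expRD addNr expR0 mul1r. Qed.

(** The terminal residual is linear in [(Z, M)], and the coefficient of [M] is the positive
    denominator of [adjoint_gain], so it can be solved for [M]. *)
Lemma free_terminalE (R : realType) (c n Gamma T p Z M : R) :
  0 < c -> 0 < n -> Gamma < T -> 0 <= p ->
  p * free_adjoint c Gamma M T + free_state c n Gamma Z M T = 0 <->
  M = adjoint_gain c n (T - Gamma) p * Z.
Proof.
move=> c0 n0 GT p0; rewrite -subr_gt0 in GT.
have den := adjoint_gain_den_gt0 c0 n0 GT p0.
have -> : p * free_adjoint c Gamma M T + free_state c n Gamma Z M T =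
    (p * expR (c * (T - Gamma)) + n * sinhc c (T - Gamma)) *
    (M - adjoint_gain c n (T - Gamma) p * Z).
  rewrite /adjoint_gain /free_adjoint /free_state; field.
  by rewrite gt_eqF.
split=> [/eqP|->]; last by rewrite subrr mulr0.
by rewrite mulf_eq0 gt_eqF //= subr_eq0 => /eqP.
Qed.

Lemma mode_contraction (R : realType) (c n T Gamma p : R)
    (z1 m1 z2 m2 : nat -> R -> R) :
  0 < c -> 0 < n -> 0 < Gamma < T -> 0 <= p ->
  (forall k, [/\ mode_ode c n 0 Gamma (z1 k.+1) (m1 k.+1), z1 k.+1 0 = 0 &
                 m1 k.+1 Gamma = m2 k Gamma] /\
             [/\ mode_ode c n Gamma T (z2 k.+1) (m2 k.+1),
                 z2 k.+1 Gamma = z1 k.+1 Gamma &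
                 p * m2 k.+1 T + z2 k.+1 T = 0]) ->
  forall k t, (1 <= k)%N -> Gamma <= t <= T ->
  z2 k.+1 t = AS1_rho c n T Gamma p * z2 k t.
Proof.
(* Index [0] carries only an initial guess, so the comparison runs from [k.+1] to [k.+2]. *)
move=> c0 n0 /andP[G0 GT] p0 h [//|k] t _ Gt.
have cn0 : c != 0 by rewrite gt_eqF.
have left_gain j : z1 j.+1 Gamma = state_gain c n Gamma * m2 j Gamma.
  have [[ode z10 <-] _] := h j.
  have GG : 0 <= Gamma <= Gamma by rewrite lexx ltW.
  have [-> ->] := mode_ode_solution cn0 ode GG; rewrite z10.
  rewrite -free_state_left; congr free_state.
  by rewrite /free_adjoint subr0 mulrCA -expRD addNr expR0 mulr1.
have right_gain j : m2 j.+1 Gamma = adjoint_gain c n (T - Gamma) p * z2 j.+1 Gamma.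
  have [_ [ode _ term]] := h j; apply/(free_terminalE _ _ c0 n0 GT p0).
  have TT : Gamma <= T <= T by rewrite lexx ltW.
  by have [<- <-] := mode_ode_solution cn0 ode TT.
have Z2 : z2 k.+2 Gamma = AS1_rho c n T Gamma p * z2 k.+1 Gamma.
  have [_ [_ -> _]] := h k.+1; rewrite left_gain right_gain.
  by rewrite /AS1_rho mulrA.
(* Since [m2] at [Gamma] is a fixed multiple of [z2] at [Gamma], each [z2 j.+1] is its value at
   [Gamma] times one fixed profile. The ratio found at [Gamma] thus holds at every [t]. *)
have z2E j : z2 j.+1 t =
    z2 j.+1 Gamma * free_state c n Gamma 1 (adjoint_gain c n (T - Gamma) p) t.
  have [_ [ode _ _]] := h j; have [_ ->] := mode_ode_solution cn0 ode Gt.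
  by rewrite right_gain -free_stateZ mulr1 mulrC.
by rewrite !z2E Z2 mulrA.
Qed.

(** * The common vector iteration: its contraction, and a run that does not vanish *)

(* With [p = gamma^-1] and [b = yhat T] these are the S1 iterates for
   [alpha = 0]; with [p = 0] and [b = 0] they are the S2 iterates. *)
Definition AS1_iterates (R : realType) (N : nat) (A : 'M[R]_N)
    (kappa nu p T Gamma : R) (y0 b : 'cV[R]_N)
    (y1 l1 y2 l2 : nat -> R -> 'cV[R]_N) : Prop :=
  forall k : nat,
    [/\ S2_ode A kappa nu 0 Gamma (y1 k.+1) (l1 k.+1),
        y1 k.+1 0 = y0 &
        l1 k.+1 Gamma = l2 k Gamma] /\
    [/\ S2_ode A kappa nu Gamma T (y2 k.+1) (l2 k.+1),
        y2 k.+1 Gamma = y1 k.+1 Gamma &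
        p *: l2 k.+1 T + y2 k.+1 T = b].

(** The exact solution, restricted to the two subintervals, is a fixed point of the iteration.
    Subtracting it cancels [y0] and [b], and each coordinate in [P^T] becomes a homogeneous scalar
    iteration. *)
Lemma AS1_iterates_contract (R : realType) (N : nat) (A P : 'M[R]_N)
    (d : 'I_N -> R) (kappa nu p T Gamma : R) (y0 b : 'cV[R]_N)
    (y l : R -> 'cV[R]_N) (y1 l1 y2 l2 : nat -> R -> 'cV[R]_N) (i : 'I_N) :
  0 < kappa * d i -> 0 < nu -> 0 < Gamma < T -> 0 <= p ->
  orthogonal_diagonalization A P d ->
  S2_ode A kappa nu 0 T y l -> y 0 = y0 -> p *: l T + y T = b ->
  AS1_iterates A kappa nu p T Gamma y0 b y1 l1 y2 l2 ->
  mode_contracts P i Gamma T y y2 (AS1_rho (kappa * d i) nu^-1 T Gamma p).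
Proof.
move=> c0 nu0 GT p0 AP yl y00 yT it.
pose g (w : 'cV[R]_N) := (P^T *m w) i 0.
have gB u w : g (u - w) = g u - g w by rewrite /g mulmxBr !mxE.
have gD u w : g (u + w) = g u + g w by rewrite /g mulmxDr !mxE.
have gZ k w : g (k *: w) = k * g w by rewrite /g -scalemxAr mxE.
have [/ltW G0 /ltW leGT] := andP GT.
have ode := mode_ode_coord i AP yl; rewrite -/g in ode.
move=> k t k1 Gt; rewrite -![(_ *m _) i 0]/(g _) !gB.
apply: (@mode_contraction R (kappa * d i) nu^-1 T Gamma p
  (fun k t => g (y1 k t) - g (y t)) (fun k t => g (l1 k t) - g (l t))
  (fun k t => g (y2 k t) - g (y t)) (fun k t => g (l2 k t) - g (l t))) => //.
  by rewrite invr_gt0.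
move=> j; have [[ode1 y10 lG] [ode2 yG yTj]] := it j; split; split.
- have h := mode_ode_coord i AP ode1.
  exact: mode_odeB h (mode_ode_subitv (lexx 0) leGT ode).
- by rewrite y10 y00 subrr.
- by rewrite lG.
- have h := mode_ode_coord i AP ode2.
  exact: mode_odeB h (mode_ode_subitv G0 (lexx T) ode).
- by rewrite yG.
- by rewrite mulrBr -!gZ addrACA -opprD -!gD yTj yT subrr.
Qed.

(** A vanishing error would be compatible with every factor; a run with a nonzero [i]-th component
    is what pins the factor down. *)
Lemma AS1_nonzero_iterates (R : realType) (N : nat) (A P : 'M[R]_N)
    (d : 'I_N -> R) (kappa nu p T Gamma : R) (i : 'I_N) :
  0 < kappa * d i -> 0 < nu -> 0 < Gamma < T -> 0 <= p ->
  orthogonal_diagonalization A P d ->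
  exists y1 l1 y2 l2 : nat -> R -> 'cV[R]_N,
    AS1_iterates A kappa nu p T Gamma 0 0 y1 l1 y2 l2 /\
    (P^T *m y2 1 Gamma) i 0 != 0.
Proof.
move=> c0 nu0 /andP[G0 GT] p0 AP; have n0 : 0 < nu^-1 by rewrite invr_gt0.
have cn0 : kappa * d i != 0 by rewrite gt_eqF.
pose c := kappa * d i; pose n := nu^-1; pose v := col i P.
pose r := AS1_rho c n T Gamma p; pose s := state_gain c n Gamma.
have Av : A *m v = d i *: v.
  rewrite /v !colE mulmxA (tr_mul_diagonalized AP).2 -mulmxA scalemxAr.
  congr (_ *m _); apply/matrixP => j k; rewrite mul_diag_mx !mxE !ord1.
  by case: eqP => [->|_]; rewrite /= ?mulr0.
have sA : s * adjoint_gain c n (T - Gamma) p = r by [].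
(* Geometric run started from adjoint value [1] at [Gamma]: step [k >= 1] receives [r ^+ k.-1],
   produces the state [s * r ^+ k.-1] at [Gamma], and returns the adjoint [r ^+ k]. *)
exists (fun k t => free_state c n 0 0 (expR (- (c * Gamma)) * r ^+ k.-1) t *: v).
exists (fun k t => free_adjoint c 0 (expR (- (c * Gamma)) * r ^+ k.-1) t *: v).
exists (fun k t => free_state c n Gamma (s * r ^+ k.-1) (r ^+ k) t *: v).
exists (fun k t => free_adjoint c Gamma (r ^+ k) t *: v); split.
- move=> k; split; split; try exact: free_eigenmode_ode.
  + by rewrite free_statea scale0r.
  + by rewrite free_adjoint_left free_adjointa.
  + by rewrite free_statea free_state_left.
  + rewrite scalerA -scalerDl (_ : _ + _ = 0) ?scale0r //.
    by apply/free_terminalE => //; rewrite exprS -sA; ring.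
- rewrite -scalemxAr mxE free_statea expr0 mulr1 mulf_neq0 //.
    by rewrite gt_eqF // mulr_gt0 ?sinhc_gt0 // mulr_gt0 ?expR_gt0.
  by rewrite /v colE mulmxA AP.1 mul1mx mxE !eqxx oner_neq0.
Qed.

(** * The limit in [gamma], and reduction of both algorithms to the common iteration *)

(** [gamma] enters only through [p = gamma^-1], which tends to [0], where the denominator of
    [adjoint_gain] is still positive. *)
Lemma cvg_AS1_rho (R : realType) (c n T Gamma : R) :
  0 < c -> 0 < n -> Gamma < T ->
  AS1_rho c n T Gamma gamma^-1 @[gamma --> +oo] --> AS1_rho c n T Gamma 0.
Proof.
move=> c0 n0 GT; rewrite -subr_gt0 in GT.
apply: cvgMl_tmp; apply: cvgMl_tmp; apply: cvgV.
  by rewrite gt_eqF // adjoint_gain_den_gt0.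
apply: cvgD; last exact: cvg_cst.
apply: cvgMr_tmp; apply/gtr0_cvgV0; last exact: cvg_id.
exact: nbhs_pinfty_gt.
Qed.

Lemma mode_contracts_inj (R : realType) (N : nat) (P : 'M[R]_N) (i : 'I_N)
    (Gamma T : R) (y2 : nat -> R -> 'cV[R]_N) (r r' : R) :
  Gamma <= T -> (P^T *m y2 1 Gamma) i 0 != 0 ->
  mode_contracts P i Gamma T (fun=> 0) y2 r ->
  mode_contracts P i Gamma T (fun=> 0) y2 r' -> r = r'.
Proof.
move=> GT nz h h'; have GG : Gamma <= Gamma <= T by rewrite lexx.
have := h 1%N Gamma isT GG; rewrite (h' 1%N Gamma isT GG) !subr0.
by move/(mulIf nz).
Qed.

Lemma zero_S2_ode (R : realType) (N : nat) (A : 'M[R]_N) (kappa nu a b : R) :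
  S2_ode A kappa nu a b (fun=> 0) (fun=> 0).
Proof.
split; try by apply: continuous_subspaceT; exact: cst_continuous.
by move=> t _; rewrite derive1_cst mulmx0 !scaler0 addr0 subr0; split.
Qed.

Lemma S1_ode_alpha0 (R : realType) (N : nat) (A : 'M[R]_N) (kappa nu : R)
    (yhat : R -> 'cV[R]_N) (a b : R) (y l : R -> 'cV[R]_N) :
  S1_ode A kappa nu 0 yhat a b y l <-> S2_ode A kappa nu a b y l.
Proof.
rewrite /S1_ode /S2_ode; suff -> : (fun t => 0 *: (y t - yhat t)) = (fun=> 0) by [].
by apply/funext => t; rewrite scale0r.
Qed.

(** Dividing by [gamma] puts the S1 condition in a form that survives the limit: at [gamma^-1 = 0]
    only the condition on [y] remains. *)
Lemma S1_terminalE (R : realType) (N : nat) (gamma : R) (l y b : 'cV[R]_N) :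
  0 < gamma -> l + gamma *: y = gamma *: b <-> gamma^-1 *: l + y = b.
Proof.
move=> g0; have gn0 : gamma != 0 by rewrite gt_eqF.
split=> [h|<-]; last by rewrite scalerDr scalerA mulfV // scale1r.
by apply: (scalerI gn0); rewrite -h scalerDr scalerA mulfV // scale1r.
Qed.

Lemma S1_AS1_iteratesE (R : realType) (N : nat) (A : 'M[R]_N)
    (kappa nu gamma T Gamma : R) (y0 : 'cV[R]_N) (yhat : R -> 'cV[R]_N)
    (y1 l1 y2 l2 : nat -> R -> 'cV[R]_N) : 0 < gamma ->
  S1_AS1_iterates A kappa nu 0 gamma T Gamma y0 yhat y1 l1 y2 l2 <->
  AS1_iterates A kappa nu gamma^-1 T Gamma y0 (yhat T) y1 l1 y2 l2.
Proof.
move=> g0; have odeE := S1_ode_alpha0 A kappa nu yhat.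
have termE := fun l y b : 'cV[R]_N => S1_terminalE l y b g0.
split=> h k; have [[/odeE ode1 y10 l1G] [/odeE ode2 y2G /termE]] := h k.
  by split.
by move=> l2T; split; split=> //; exact/odeE || exact/termE.
Qed.

Lemma S2_AS1_iteratesE (R : realType) (N : nat) (A : 'M[R]_N)
    (kappa nu T Gamma : R) (y0 : 'cV[R]_N)
    (y1 l1 y2 l2 : nat -> R -> 'cV[R]_N) :
  S2_AS1_iterates A kappa nu T Gamma y0 y1 l1 y2 l2 <->
  AS1_iterates A kappa nu 0 T Gamma y0 0 y1 l1 y2 l2.
Proof.
by split=> h k; have := h k; rewrite scale0r add0r.
Qed.

Unset Implicit Arguments.

Theorem theorem2 (R : realType) (N : nat) (hN : (1 <= N)%N)
    (A : 'M[R]_N) (hA : A^T = A)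
    (d : 'I_N -> R) (hd : eigenvalue_list A d) (hdpos : forall i : 'I_N, 0 < d i)
    (kappa nu T Gamma : R) (hkappa : 0 < kappa) (hnu : 0 < nu) (hT : 0 < T)
    (hGamma : 0 < Gamma < T) (i : 'I_N) :
  exists (rhoS1 : R -> R) (rhoS2 : R),
    [/\ forall gamma : R, 0 < gamma ->
          unique (S1_AS1_contraction_factor A d kappa nu 0 gamma T Gamma i)
            (rhoS1 gamma),
        unique (S2_AS1_contraction_factor A d kappa nu T Gamma i) rhoS2 &
        rhoS1 gamma @[gamma --> +oo] --> rhoS2].
Proof.
have [P AP] := exists_orthogonal_diagonalization hA hd.
have c0 : 0 < kappa * d i by rewrite mulr_gt0.
have [_ GT] := andP hGamma.
pose rho := AS1_rho (kappa * d i) nu^-1 T Gamma.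
exists (fun gamma => rho gamma^-1), (rho 0); split.
- move=> gamma g0; have p0 : 0 <= gamma^-1 by rewrite invr_ge0 ltW.
  have factor : S1_AS1_contraction_factor A d kappa nu 0 gamma T Gamma i (rho gamma^-1).
    move=> Q y0 yhat y l y1 l1 y2 l2 AQ [/S1_ode_alpha0 ode y00 lT].
    move=> /S1_AS1_iteratesE it; apply: AS1_iterates_contract AQ ode y00 _ (it g0) => //.
    by apply/S1_terminalE => //; rewrite lT scalerBr opprB addrNK.
  (* Uniqueness: a competing factor [r] is tested on zero data, whose exact solution is zero, so
     that the iterates are their own errors. *)
  split=> // r /(_ P 0 (fun=> 0) (fun=> 0) (fun=> 0)) h.
  have [y1 [l1 [y2 [l2 [it nz]]]]] := AS1_nonzero_iterates c0 hnu hGamma p0 AP.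
  have sol : S1_solution A kappa nu 0 gamma T 0 (fun=> 0) (fun=> 0) (fun=> 0).
    split=> //; first by apply/S1_ode_alpha0; exact: zero_S2_ode.
    by rewrite subr0 scaler0 oppr0.
  have {}it : S1_AS1_iterates A kappa nu 0 gamma T Gamma 0 (fun=> 0) y1 l1 y2 l2.
    exact/S1_AS1_iteratesE.
  apply: (mode_contracts_inj (ltW GT) nz); [exact: factor AP sol it|exact: h AP sol it].
- have factor : S2_AS1_contraction_factor A d kappa nu T Gamma i (rho 0).
    move=> Q y0 y l y1 l1 y2 l2 AQ [ode y00 yT] /S2_AS1_iteratesE it.
    by apply: AS1_iterates_contract AQ ode y00 _ it => //; rewrite scale0r add0r.
  split=> // r /(_ P 0 (fun=> 0) (fun=> 0)) h.
  have [y1 [l1 [y2 [l2 [it nz]]]]] := AS1_nonzero_iterates c0 hnu hGamma (lexx 0) AP.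
  have sol : S2_solution A kappa nu T 0 (fun=> 0) (fun=> 0).
    by split=> //; exact: zero_S2_ode.
  have {}it : S2_AS1_iterates A kappa nu T Gamma 0 y1 l1 y2 l2.
    exact/S2_AS1_iteratesE.
  apply: (mode_contracts_inj (ltW GT) nz); [exact: factor AP sol it|exact: h AP sol it].
- by apply: cvg_AS1_rho; rewrite ?invr_gt0.
Qed.
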